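(* Let $G$ be a Sylow-cyclic group and let $\mu(G)$ be its maximum cyclic characteristic subgroup. The following are equivalent: (1) $G$ is freely representable. (2) Every prime dividing the order of $G$ also divides the order of $\mu(G)$. (3) For every prime $p$ dividing the order of $G$ there is a unique subgroup of $G$ of order $p$.
   Context: A finite group $G$ is Sylow-cyclic if every Sylow subgroup of $G$ is cyclic. For a Sylow-cyclic group $G$, the product of all normal cyclic subgroups of $G$ is itself a cyclic characteristic subgroup of $G$; it contains every normal cyclic subgroup of $G$, is denoted $\mu(G)$, and is called the maximum (or maximal) cyclic characteristic subgroup of $G$. A free linear representation of a group $G$ over a field $F$ is a linear action of $G$ on an $F$-vector space $V \neq 0$ such that $gv \neq v$ for all $g \neq 1$ in $G$ and all nonzero $v \in V$. A finite group is freely representable if it has a free linear representation over $\mathbb{C}$. *)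

(* Defs.v *)
From HB Require Import structures.
From mathcomp Require Import all_boot all_order all_algebra all_fingroup all_solvable.
From mathcomp Require Import complex.
From mathcomp Require Import reals.

Set Implicit Arguments.
Unset Strict Implicit.
Unset Printing Implicit Defensive.

Import GroupScope.

(** [\prod_(...)%G] is the join of the subgroups, which is their product here
    because every factor is normal in [G]. *)
Definition max_cyclic_char (gT : finGroupType) (G : {group gT}) : {group gT} :=
  (\prod_(H : {group gT} | (H <| G) && cyclic H) H)%G.

(** [V] may have infinite dimension. The values of [rho] outside [G] are
    irrelevant. *)
Definition free_linear_representation (F : fieldType) (gT : finGroupType)
    (G : {group gT}) (V : lmodType F) (rho : gT -> V -> V) : Prop :=
  [/\ exists v : V, v <> 0%R,
      {in G, forall g, linear (rho g)},
      rho 1 =1 id,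
      {in G &, forall g h, rho (g * h) =1 rho g \o rho h}
    & {in G, forall g, g <> 1 -> forall v : V, v <> 0%R -> rho g v <> v}].

(** The field of complex numbers is [R[i]], for [R] any model of the reals. *)
Definition freely_representable (R : realType) (gT : finGroupType)
    (G : {group gT}) : Prop :=
  exists (V : lmodType R[i]) (rho : gT -> V -> V),
    free_linear_representation G rho.

(* Main.v *)
(** (1) => (2): A Sylow-cyclic group is solvable (transfer to a Sylow subgroup
    for the smallest prime), so its Fitting subgroup [F], which is cyclic,
    contains its centralizer. If [p] did not divide [#|F|], a subgroup [Z] of
    order [p] would act fixed-point-freely on [Y = [F, Z] <> 1]. For a vector
    [v], the double sum of [(z ^ y) v] over [Y] and [Z] vanishes because each
    conjugate of [Z] has no nonzero fixed vector; the terms with [z <> 1] also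
    sum to zero since [z ^ y] runs over the coset [z Y], so [#|Y| v = 0].
    (2) => (3): the subgroup of order [p] of [mu(G)] is normal in [G], hence in
    every Sylow [p]-subgroup, and these are cyclic.
    (3) => (1): all elements of prime order lie in [mu(G)], so inducing a
    faithful linear character of [mu(G)] to [G] gives a free representation. *)

Require Import Defs.
From HB Require Import structures.
From mathcomp Require Import all_boot all_order all_algebra all_fingroup all_solvable.
From mathcomp Require Import complex.
From mathcomp Require Import reals.
From mathcomp Require Import cyclotomic separable.

Set Implicit Arguments.
Unset Strict Implicit.
Unset Printing Implicit Defensive.

Import GroupScope GRing.Theory Num.Theory.

(** * Solvability of Sylow-cyclic groups *)

(** Burnside's fusion argument: conjugacy in [G] between elements of [P] is realized in ['N_G(P)],
    which here acts trivially on [P]. *)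
Lemma abelian_Sylow_fusion (gT : finGroupType) (G P : {group gT}) p x g :
    p.-Sylow(G) P -> abelian P -> 'N_G(P) \subset 'C(P) ->
  x \in P -> g \in G -> x ^ g \in P -> x ^ g = x.
Proof.
move=> sylP abP sNC Px Gg Pxg; have sPG := pHall_sub sylP.
pose C := 'C_G[x ^ g]%G.
have sCG: C \subset G by apply: subsetIl.
have sPC: P \subset C.
  by rewrite subsetI sPG sub_cent1 (subsetP abP).
have sPgC: P :^ g \subset C.
  by rewrite subsetI conj_subG //= sub_cent1 centJ memJ_conjg (subsetP abP).
have sylPC: p.-Sylow(C) P := pHall_subl sPC sCG sylP.
have sylPgC: p.-Sylow(C) (P :^ g)%G.
  by apply: pHall_subl sPgC sCG _; rewrite pHallJ.
(* [P] and [P :^ g] are Sylow in ['C_G[x ^ g]], so [g] can be corrected there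
   to normalize [P]. *)
have [c Cc defP] := Sylow_trans sylPgC sylPC.
have [Gc cxc] := setIP Cc.
have Ngc: g * c \in 'N_G(P).
  by rewrite inE groupM //=; apply/normP; rewrite conjsgM; apply/esym.
have cgc := subsetP sNC _ Ngc.
have <-: x ^ (g * c) = x ^ g.
  by rewrite conjgM; apply/conjg_fixP/commgP/cent1P; rewrite cent1C.
by apply/conjg_fixP/commgP/esym; apply: (centP cgc).
Qed.

Import FiniteModule.

(** [K] is the kernel of the transfer from [G] to [P]. On [P] the transfer is [x |-> x ^+ #|G : P|],
    with index prime to [p], so no element of order [p] is killed. *)
Lemma Burnside_transfer_kernel (gT : finGroupType) (G P : {group gT}) p :
    p.-Sylow(G) P -> abelian P -> 'N_G(P) \subset 'C(P) ->
  exists K : {group gT}, [/\ K <| G, p^'.-group K & abelian (G / K)].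
Proof.
move=> sylP abP sNC; have sPG := pHall_sub sylP.
have abI: abelian (idm P @* P) by rewrite morphim_idm.
have imP x: x \in P -> x \in idm P @* P by rewrite morphim_idm.
pose tau := transfer_morphism G abI.
have tauP x : x \in P -> tau x = fmod abI (x ^+ #|G : P|).
  move=> Px; have Gx := subsetP sPG x Px.
  have trX := transversalP (rcosets_cycle_partition sPG Gx).
  have sXG := subsetP (transversal_sub trX).
  (* Each cycle of [x] on the right cosets contributes a conjugate in [P] of a power of [x], which
     equals that power by fusion; the cycle lengths add up to the index. *)
  rewrite /tau /= (transfer_cycle_expansion sPG abI Gx trX).
  rewrite -(sum_index_rcosets_cycle sPG Gx trX).
  rewrite (big_morph (fun n => fmod abI (x ^+ n)) (id1 := 0%R) (op1 := +%R%R));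
    first 1 last.
  - by move=> m n; rewrite expgD fmodM ?imP ?groupX.
  - by rewrite expg0 fmod1.
  apply: eq_bigr => y Xy; congr (fmod _ _); rewrite /= /idm.
  apply: (abelian_Sylow_fusion sylP) => //; rewrite ?groupX ?groupV ?sXG //.
  rewrite conjgE invgK mulgA -mem_rcoset.
  exact: mulg_exp_card_rcosets.
exists ('ker tau)%G; split; first exact: ker_normal.
- apply/pgroupP=> q pr_q /(Cauchy pr_q)[x Kx ox].
  apply/negP=> /eqP def_q; rewrite {q}def_q in pr_q ox.
  have Gx := dom_ker Kx.
  have px: p.-group <[x]> by rewrite /pgroup -orderE ox pnat_id.
  have sxG: <[x]> \subset G by rewrite cycle_subG.
  have [g Gg sxP] := Sylow_Jsub sylP sxG px.
  have Pxg: x ^ g \in P by rewrite -cycle_subG cycleJ.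
  have Kxg: x ^ g \in 'ker tau by rewrite memJ_norm // (subsetP (ker_norm _)).
  have := mker Kxg; rewrite tauP // => /congr_fmod; rewrite fmodK; last first.
    exact/imP/groupX.
  move/eqP; rewrite [fmval _]fmval0 -order_dvdn orderJ ox => pdvd.
  by have [_ _] := and3P sylP; rewrite p'natE // pdvd.
- rewrite (isog_abelian (first_isog tau)); apply/centsP=> u _ v _.
  by have := GRing.addrC (u : fmod_of abI) v.
Qed.

(** The quotient of ['N_G(P)] by the centralizer of [P] embeds in the automorphism group of [P], of
    order a power of [p] times [p - 1]. A prime divisor [q] of its order is at least [p] by
    minimality and is not [p] because [P] is abelian, so it would divide [p - 1]. *)
Lemma norm_cyclic_Sylow_pdiv (gT : finGroupType) (G P : {group gT}) :
  (pdiv #|G|).-Sylow(G) P -> cyclic P -> 'N_G(P) \subset 'C(P).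
Proof.
set p := pdiv _ => sylP cycP; have sPG := pHall_sub sylP.
(* [pdiv 1] is [1], not a prime, so the trivial group is treated apart. *)
have [G1 | ntG] := eqVneq #|G| 1%N.
  by have /card1_trivg-> := G1; rewrite setIC setIg1 sub1G.
have p_pr: prime p by rewrite pdiv_prime // ltn_neqAle eq_sym ntG cardG_gt0.
set N := 'N_G(P); have nPN: N \subset 'N(P) by apply: subsetIr.
have sCN: 'C_N(P) \subset N by apply: subsetIl.
have sPC: P \subset 'C_N(P).
  by rewrite !subsetI sPG normG andTb; apply: cyclic_abelian.
have oA: #|N / 'C_N(P)| %| totient #|P|.
  rewrite -card_Aut_cyclic // -ker_conj_aut (card_isog (first_isog_loc _ _)) //.
  exact: cardSg (Aut_conj_aut _ _).
suffices: #|N / 'C_N(P)| = 1%N.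
  move/card1_trivg/trivgP; rewrite quotient_sub1 ?subsetI; last first.
    by rewrite normsI ?normG // (subset_trans nPN) ?cent_norm.
  by case/andP.
apply: contraTeq isT => nt.
have q_pr: prime (pdiv #|N / 'C_N(P)|).
  by rewrite pdiv_prime // ltn_neqAle eq_sym nt cardG_gt0.
set q := pdiv _ in q_pr; have qdv: q %| #|N / 'C_N(P)| by apply: pdiv_dvd.
have leq: p <= q.
  apply: pdiv_min_dvd (prime_gt1 q_pr) _; apply: dvdn_trans qdv _.
  apply: dvdn_trans (dvdn_quotient _ _) (cardSg _); exact: subsetIl.
have pP: p.-group P := pHall_pgroup sylP.
have nq: q != p.
  apply: contraTneq qdv => ->; rewrite -p'natE // card_quotient; last first.
    by rewrite normsI ?normG // (subset_trans nPN) ?cent_norm.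
  have sylPN: p.-Sylow(N) P.
    by apply: pHall_subl sylP; rewrite ?subsetIl // subsetI sPG normG.
  have [_ _] := and3P sylPN; apply: pnat_dvd.
  by rewrite -(Lagrange_index sCN sPC) dvdn_mulr.
have ntP: P :!=: 1.
  apply: contraTneq p_pr => P1.
  have := card_Hall sylP; rewrite P1 cards1 => /esym p1.
  have : p %| #|G|`_p.
    rewrite p_part -{1}(expn1 p) dvdn_exp2l // logn_gt0 pi_pdiv.
    by rewrite ltn_neqAle eq_sym ntG cardG_gt0.
  by rewrite p1 dvdn1 => /eqP->.
have [_ _ [e oP]] := pgroup_pdiv pP ntP.
have := dvdn_trans qdv oA; rewrite oP totient_pfactor //= Euclid_dvdM //.
rewrite Euclid_dvdX // [q %| p]dvdn_prime2 // (negPf nq) /= orbF.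
rewrite gtnNdvd //; first by rewrite -subn1 subn_gt0 prime_gt1.
by rewrite prednK ?prime_gt0.
Qed.

Lemma Zgroup_solvable (gT : finGroupType) (G : {group gT}) :
  Zgroup G -> solvable G.
Proof.
have [n] := ubnP #|G|; elim: n G => // n IHn G /ltnSE-leGn ZG.
have [G1 | ntG] := eqVneq #|G| 1%N.
  by have /card1_trivg-> := G1; apply: solvable1.
have gt1: 1 < #|G| by rewrite ltn_neqAle eq_sym ntG cardG_gt0.
have [P sylP] := Sylow_exists (pdiv #|G|) G.
have cycP: cyclic P by apply: (forall_inP ZG); apply: p_Sylow sylP.
have [K [nsKG p'K abGK]] := Burnside_transfer_kernel sylP
  (cyclic_abelian cycP) (norm_cyclic_Sylow_pdiv sylP cycP).
have sKG := normal_sub nsKG.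
(* [K] is proper because its order is prime to [pdiv #|G|], so induction applies to it. *)
rewrite (series_sol nsKG) (abelian_sol abGK) andbT; apply: IHn (ZgroupS sKG ZG).
apply: leq_trans leGn; apply: proper_card; rewrite properEneq sKG andbT.
apply: contraTneq p'K => ->.
by rewrite /pgroup p'natE ?pdiv_prime // negbK pdiv_dvd.
Qed.

(** With [C] the centralizer of [F], the Fitting subgroup of [C / (F :&: C)] lifts to some [K]
    normal in [G]. As [F :&: C] is central in [K], [K] is nilpotent and lies in [F]. So that Fitting
    subgroup is trivial, and by solvability so is the quotient. *)
Lemma cent_sub_Fitting (gT : finGroupType) (G : {group gT}) :
  solvable G -> 'C_G('F(G)) \subset 'F(G).
Proof.
move=> solG; set F := 'F(G); set C := 'C_G(F).
have nsFG: F <| G := Fitting_normal G.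
have nsCG: C <| G.
  rewrite /normal subsetIl normsI ?normG //.
  exact: subset_trans (normal_norm nsFG) (cent_norm _).
have nsDG: F :&: C <| G by apply: normalI.
have nsDC: F :&: C <| C by apply: normalS (normal_sub nsCG) nsDG; apply: subsetIr.
suffices: 'F(C / (F :&: C)) == 1.
  rewrite trivg_Fitting ?quotient_sol ?(solvableS (normal_sub nsCG)) //.
  by rewrite -subG1 quotient_sub1 ?normal_norm // subsetI => /andP[].
have nsFG' : 'F(C / (F :&: C)) <| G / (F :&: C).
  by rewrite gFnormal_trans ?quotient_normal.
have [K defK sDK nsKG] := inv_quotientN nsDG nsFG'.
have nsDK: F :&: C <| K := normalS sDK (normal_sub nsKG) nsDG.
have sKC: K \subset C.
  rewrite -(quotientSGK (normal_norm nsDK)) ?subsetIr // -defK.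
  exact: Fitting_sub.
rewrite defK -subG1 quotient_sub1 ?normal_norm // subsetI sKC andbT.
apply: Fitting_max nsKG _; rewrite -quotient_center_nil.
have sDZ: F :&: C \subset 'Z(K).
  rewrite subsetI sDK centsC (subset_trans sKC) //.
  by rewrite (subset_trans (subsetIr _ _)) // centS // subsetIl.
rewrite -(isog_nil (third_isog sDZ nsDK (center_normal K))) quotient_nil //.
by have := Fitting_nil (C / (F :&: C)); rewrite defK.
Qed.

(** * The maximum cyclic characteristic subgroup *)

Section MaxCyclicChar.

Variables (gT : finGroupType) (G : {group gT}).

Lemma max_cyclic_char_normal : max_cyclic_char G <| G.
Proof.
rewrite /normal bigprodGE gen_subG; apply/andP; split.
  by apply/bigcupsP=> H /andP[/normal_sub].
by apply/norms_gen/norms_bigcup/bigcapsP=> H /andP[/normal_norm].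
Qed.

Lemma sub_max_cyclic_char (H : {group gT}) :
  H <| G -> cyclic H -> H \subset max_cyclic_char G.
Proof.
by move=> nsHG cycH; rewrite bigprodGE sub_gen // (bigcup_sup H) // nsHG.
Qed.

(** Normal cyclic subgroups lie in ['F(G)], so their join is nilpotent, and a nilpotent Sylow-cyclic
    group is cyclic. *)
Lemma max_cyclic_char_cyclic : Zgroup G -> cyclic (max_cyclic_char G).
Proof.
move=> ZG; apply: nil_Zgroup_cyclic.
  exact: ZgroupS (normal_sub max_cyclic_char_normal) ZG.
apply: nilpotentS (Fitting_nil G); rewrite bigprodGE gen_subG.
apply/bigcupsP=> H /andP[nsHG cycH].
exact: Fitting_max nsHG (abelian_nil (cyclic_abelian cycH)).
Qed.

End MaxCyclicChar.

(** * Free linear representations *)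

Local Open Scope ring_scope.

(** In characteristic zero ['X^n - 1] is separable, so it has [n] distinct roots, one of which must
    be primitive. *)
Lemma exists_primitive_root (C : numClosedFieldType) n :
  (0 < n)%N -> exists z : C, n.-primitive_root z.
Proof.
pose p : {poly C} := 'X^n - 1; have [r Dp] := closed_field_poly_normal p.
move=> n_gt0; rewrite (monicP _) ?monicXnsubC // scale1r in Dp.
have rn1: all n.-unity_root r by apply/allP=> z; rewrite -root_prod_XsubC -Dp.
have sz_r: (n < (size r).+1)%N.
  by rewrite -(size_prod_XsubC r id) -Dp size_XnsubC.
have [|z] := hasP (has_prim_root n_gt0 rn1 _ sz_r); last by exists z.
by rewrite -separable_prod_XsubC -Dp separable_Xn_sub_1 // pnatr_eq0 -lt0n.
Qed.

Section FreeRepresentation.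

Variables (F : fieldType) (gT : finGroupType) (G : {group gT}).
Variables (V : lmodType F) (rho : gT -> V -> V).
Hypothesis free_rho : free_linear_representation G rho.

Lemma free_rep_sumr (I : finType) (P : pred I) (E : I -> V) g :
  g \in G -> rho g (\sum_(i | P i) E i) = \sum_(i | P i) rho g (E i).
Proof.
have [_ lin_rho _ _ _] := free_rho => Gg.
pose f : {linear V -> V} := HB.pack (rho g)
  (GRing.isLinear.Build F V V *:%R (rho g) (lin_rho g Gg)).
exact: (linear_sum f).
Qed.

(** The sum is fixed by every element of [H], hence by a nontrivial one. *)
Lemma free_rep_sum0 (H : {group gT}) v :
  H \subset G -> H :!=: 1%g -> \sum_(h in H) rho h v = 0.
Proof.
have [_ lin_rho _ rhoM free] := free_rho.
move=> sHG /trivgPn[x Hx ntx]; have Gx := subsetP sHG x Hx.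
apply/eqP; apply: contraT => /eqP nz; case: (free x Gx _ _ nz); first exact/eqP.
rewrite free_rep_sumr // [RHS](reindex_inj (mulgI x)) /=.
by apply: eq_big => h; rewrite ?groupMl // => Hh; rewrite rhoM ?(subsetP sHG).
Qed.

Lemma free_rep_semiregular (A B : {group gT}) :
    A \subset G -> B \subset G -> B \subset 'N(A) -> semiregular A B ->
  A :!=: 1%g -> B :!=: 1%g -> #|A|%:R = 0 :> F.
Proof.
have [[v nzv] lin_rho rho1 rhoM _] := free_rho.
move=> sAG sBG nAB regAB ntA ntB.
have sum0: \sum_(b in B) \sum_(a in A) rho (b ^ a)%g v = 0.
  (* For fixed [a] the inner sum runs over the nontrivial subgroup [B :^ a]. *)
  rewrite exchange_big /= big1 // => a Aa.
  rewrite -[RHS](@free_rep_sum0 (B :^ a)%G v); first 1 last.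
  - by rewrite conj_subG ?(subsetP sAG).
  - by rewrite -(conjs1g a) (inj_eq (@conjsg_inj _ a)).
  rewrite big_imset //=; exact: in2W (conjg_inj a).
apply/eqP; apply: contraT => nzA; case: nzv; apply/eqP.
(* The term [b = 1] contributes [#|A|] copies of [v]; all other terms will vanish. *)
move/eqP: sum0; rewrite (big_setD1 1%g) //= [X in _ + X]big1 => [|b].
  under eq_bigr do rewrite conj1g rho1.
  by rewrite addr0 sumr_const -scaler_nat scaler_eq0 (negPf nzA).
case/setD1P=> ntb Bb.
(* Semiregularity makes [a |-> [~ b, a]] a permutation of [A], and [b ^ a = b * [~ b, a]]. *)
have inj_b: {in A &, injective (fun a => [~ b, a])%g}.
  move=> a c Aa Ac; rewrite /commg => /mulgI eq_ac.
  suffices: (a * c^-1)%g \in 'C_A[b]%g.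
    by rewrite regAB ?inE ?ntb // -eq_mulgV1 => /eqP.
  rewrite inE groupM ?groupV //; apply/cent1P/esym/commgP/conjg_fixP.
  by rewrite conjgM eq_ac conjgK.
have def_b: (fun a => [~ b, a])%g @: A = A.
  apply/eqP; rewrite eqEcard card_in_imset // leqnn andbT.
  apply/subsetP=> _ /imsetP[a Aa ->]; rewrite commgEr groupM //.
  by rewrite memJ_norm ?groupV ?(subsetP nAB).
have Gb := subsetP sBG b Bb.
transitivity (\sum_(a in A) rho b (rho [~ b, a]%g v)).
  apply: eq_bigr => a Aa; rewrite conjg_mulR rhoM //.
  by rewrite (subsetP sAG) // -def_b imset_f.
rewrite -free_rep_sumr // -(big_imset (fun a => rho a v) inj_b) def_b.
rewrite free_rep_sum0 //.
by have := @free_rep_sumr bool pred0 (fun=> 0) b Gb; rewrite !big_pred0.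
Qed.

End FreeRepresentation.


(* When [<[a]> <| G] and [z] has multiplicative order [#[a]], [induced] is the
   representation of [G] induced from the character [a |-> z] of [<[a]>]. *)
Section InducedRepresentation.

Variables (F : fieldType) (gT : finGroupType) (G : {group gT}) (a : gT) (z : F).

Definition induced_pred : pred {ffun gT -> F^o} :=
  fun f => [forall x in G, f (a * x)%g == z * f x] &&
           [forall x in ~: G, f x == 0].

Lemma induced_predP (f : {ffun gT -> F^o}) :
  reflect ({in G, forall x, f (a * x)%g = z * f x} /\
           {in ~: G, forall x, f x = 0}) (f \in induced_pred).
Proof.
apply: (iffP andP) => [] [Hz H0]; split.
- by move=> x Gx; apply/eqP; apply: (forall_inP Hz).
- by move=> x Gx; apply/eqP; apply: (forall_inP H0).
- by apply/forall_inP=> x Gx; apply/eqP; apply: Hz.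
- by apply/forall_inP=> x Gx; apply/eqP; apply: H0.
Qed.

Lemma induced_submod_closed : submod_closed induced_pred.
Proof.
split=> [|c f g /induced_predP[fz f0] /induced_predP[gz g0]];
  apply/induced_predP; split=> x Gx; rewrite !ffunE.
- by rewrite mulr0.
- by [].
- by rewrite fz ?gz // mulrDr scalerAr.
- by rewrite f0 ?g0 // scaler0 addr0.
Qed.

HB.instance Definition _ :=
  GRing.isSubmodClosed.Build F {ffun gT -> F^o} induced_pred induced_submod_closed.

Record induced := Induced { induced_val : {ffun gT -> F^o};
                            _ : induced_val \in induced_pred }.
HB.instance Definition _ := [isSub for induced_val].
HB.instance Definition _ := [Choice of induced by <:].
HB.instance Definition _ := [SubChoice_isSubLmodule of induced by <:].

(* Outside [G] the right translate need not satisfy [induced_pred], and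
   [insubd] then returns [0]. *)
Definition induced_act (g : gT) (u : induced) : induced :=
  insubd 0 [ffun x => val u (x * g)%g].

Lemma induced_actE g u x : g \in G -> val (induced_act g u) x = val u (x * g)%g.
Proof.
move=> Gg; have /induced_predP[uz u0] := valP u.
rewrite val_insubd ifT ?ffunE //; apply/induced_predP; split=> y Gy.
  by rewrite !ffunE -mulgA uz // groupM.
by rewrite ffunE u0 // inE groupMr -?in_setC.
Qed.

Hypotheses (nsaG : <[a]> <| G) (prim_z : #[a].-primitive_root z).

Lemma induced_nontrivial : exists u : induced, u <> 0.
Proof.
have Ga: a \in G by rewrite -cycle_subG normal_sub.
(* The character [a ^+ k |-> z ^+ k], extended by zero off [<[a]>]. *)
pose f : {ffun gT -> F^o} :=
  [ffun x => if [pick k : 'I_#[a] | x == a ^+ k]%g is Some k then z ^+ k else 0].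
have fE j : f (a ^+ j)%g = z ^+ j.
  rewrite ffunE; case: pickP => [k /eqP eq_k | /(_ (Ordinal (ltn_pmod j (order_gt0 a))))].
    apply/eqP; rewrite (eq_prim_root_expr prim_z) -eq_expg_mod_order.
    by rewrite eq_k.
  by rewrite eq_expg_mod_order /= modn_mod eqxx.
have f0 x : x \notin <[a]>%g -> f x = 0.
  move=> ax; rewrite ffunE; case: pickP => // k /eqP def_x.
  by rewrite def_x mem_cycle in ax.
have f_ind: f \in induced_pred.
  apply/induced_predP; split=> x Gx; last first.
    apply: f0; apply: contraL Gx; rewrite inE negbK.
    exact: (subsetP (normal_sub nsaG)).
  have [/cycleP[j ->] | ax] := boolP (x \in <[a]>%g).
    by rewrite -expgS !fE exprS.
  by rewrite !f0 ?mulr0 // groupMl ?cycle_id.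
exists (Induced f_ind) => /(congr1 val)/ffunP/(_ 1%g)/eqP.
by rewrite /= -(expg0 a) fE ffunE oner_eq0.
Qed.

(** Since [x * g = (g ^ x^-1) * x] and [g ^ x^-1] is a nontrivial power [a ^+ j], a fixed [u]
    satisfies [u x = z ^+ j * u x] with [z ^+ j] different from 1. *)
Lemma induced_fixed0 g u :
  g \in <[a]>%g -> g != 1%g -> induced_act g u = u -> u = 0.
Proof.
have sAG := subsetP (normal_sub nsaG); have nAG := subsetP (normal_norm nsaG).
move=> ag ntg fix_u; have /induced_predP[uz u0] := valP u.
apply/val_inj/ffunP=> x; rewrite [RHS]ffunE.
have [Gx | G'x] := boolP (x \in G); last by rewrite u0 // inE.
have uzX j : val u (a ^+ j * x)%g = z ^+ j * val u x.
  elim: j => [|j IHj]; first by rewrite mul1g mul1r.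
  rewrite expgS exprS -mulgA -mulrA uz ?IHj //.
  by rewrite groupM // sAG ?mem_cycle.
have : (g ^ x^-1)%g \in <[a]>%g by rewrite memJ_norm // groupV nAG.
case/cycleP=> j def_gx.
have : val u x = z ^+ j * val u x.
  rewrite -{1}fix_u induced_actE ?sAG // -uzX -def_gx.
  by rewrite conjgE invgK mulgA mulgKV.
move/eqP; rewrite -subr_eq0 -{1}[val u x]mul1r -mulrBl mulf_eq0 => /orP[|/eqP //].
rewrite subr_eq0 eq_sym -(expr0 z) (eq_prim_root_expr prim_z).
rewrite -eq_expg_mod_order -def_gx expg0 -(conj1g x^-1) (inj_eq (conjg_inj _)).
by rewrite (negPf ntg).
Qed.

(** A vector fixed by [g] is fixed by a power of [g] of prime order, which lies in [<[a]>]. *)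
Lemma induced_free_rep :
    {in G, forall g, prime #[g] -> g \in <[a]>%g} ->
  free_linear_representation G induced_act.
Proof.
move=> prime_a.
have actM:
    {in G &, forall g h, induced_act (g * h)%g =1 induced_act g \o induced_act h}.
  move=> g h Gg Gh u; apply/val_inj/ffunP=> x.
  by rewrite /= !induced_actE ?groupM // mulgA.
have act1: induced_act 1%g =1 id.
  by move=> u; apply/val_inj/ffunP=> x; rewrite induced_actE // mulg1.
split=> //; first exact: induced_nontrivial.
  move=> g Gg c u v; apply/val_inj/ffunP=> x.
  by rewrite induced_actE // !ffunE !induced_actE.
move=> g Gg /eqP ntg u nzu fix_u; case: nzu.
have [p pr_p pg] : exists2 p, prime p & (p %| #[g])%N.
  exists (pdiv #[g]); rewrite ?pdiv_dvd ?pdiv_prime //.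
  by rewrite order_gt1.
pose k := (#[g] %/ p)%N.
have ogk: #[g ^+ k]%g = p.
  by rewrite orderXdiv ?dvdn_div // divnA ?mulKn ?order_gt0.
apply: (@induced_fixed0 (g ^+ k)%g).
- by apply: prime_a; rewrite ?groupX ?ogk.
- by rewrite -order_gt1 ogk prime_gt1.
- elim: (k) => [|n IHn]; first exact: act1.
  by rewrite expgS actM ?groupX //= IHn.
Qed.

End InducedRepresentation.

Local Close Scope ring_scope.

Theorem theorem81 (R : realType) (gT : finGroupType) (G : {group gT})
    (G_Sylow_cyclic : Zgroup G) :
  [<-> freely_representable R G;
       forall p : nat, prime p -> p %| #|G| -> p %| #|max_cyclic_char G|;
       forall p : nat, prime p -> p %| #|G| ->
         exists! H : {group gT}, H \subset G /\ #|H| = p].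
Proof.
have cyc_mu := max_cyclic_char_cyclic G_Sylow_cyclic.
have ns_mu := max_cyclic_char_normal G.
tfae.
- case=> V [rho free_rho] p pr_p pG.
  have cycF: cyclic 'F(G).
    exact: nil_Zgroup_cyclic (ZgroupS (Fitting_sub G) _) (Fitting_nil G).
  have sFmu: 'F(G) \subset max_cyclic_char G.
    exact: sub_max_cyclic_char (Fitting_normal G) cycF.
  apply: dvdn_trans (cardSg sFmu); apply: contraT => p'F.
  have [x Gx ox] := Cauchy pr_p pG.
  have sxG: <[x]> \subset G by rewrite cycle_subG.
  have coFx: coprime #|'F(G)| #|<[x]>|.
    by rewrite -orderE ox coprime_sym prime_coprime.
  have nFx: <[x]> \subset 'N('F(G)).
    exact: subset_trans sxG (normal_norm (Fitting_normal G)).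
  have sYF: [~: 'F(G), <[x]>] \subset 'F(G) by rewrite commg_subl.
  (* Under coprime action on an abelian group, the commutator meets the centralizer trivially; each
     nontrivial [b] generates [<[x]>], of prime order. *)
  have regY: semiregular [~: 'F(G), <[x]>] <[x]>.
    move=> b /setD1P[ntb xb]; rewrite -cent_cycle.
    suffices ->: <[b]> = <[x]>.
      exact: coprime_abel_cent_TI nFx coFx (cyclic_abelian cycF).
    apply/eqP; rewrite eqEcard cycle_subG xb -!orderE ox.
    have /(prime_nt_dvdP pr_p)-> : #[b] %| p by rewrite -ox order_dvdG.
      by rewrite leqnn.
    by rewrite order_eq1.
  (* Otherwise [x] centralizes ['F(G)], so it lies in it, and [p] divides its order. *)
  have ntY: [~: 'F(G), <[x]>]%G :!=: 1.
    apply: contra p'F => /eqP/commG1P; rewrite centsC => cFx.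
    rewrite -ox; apply: cardSg; apply: subset_trans (cent_sub_Fitting _).
      by rewrite subsetI sxG.
    exact: Zgroup_solvable.
  have ntx: <[x]> :!=: 1 by rewrite -cardG_gt1 -orderE ox prime_gt1.
  have /eqP := free_rep_semiregular free_rho (subset_trans sYF (Fitting_sub G))
    sxG (commg_normr _ _) regY ntY ntx.
  by rewrite pnatr_eq0 -leqn0 leqNgt cardG_gt0.
- move=> mu_p p pr_p pG.
  have [x mux ox] := Cauchy pr_p (mu_p p pr_p pG).
  have nsxG: <[x]> <| G.
    by apply: char_normal_trans ns_mu; rewrite sub_cyclic_char ?cycle_subG.
  exists <[x]>%G; split=> [|K [sKG oK]].
    by rewrite normal_sub // -orderE.
  have pK: p.-group K by rewrite /pgroup oK pnat_id.
  have px: p.-group <[x]> by rewrite /pgroup -orderE ox pnat_id.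
  have [P sylP sKP] := Sylow_superset sKG pK.
  have sxP: <[x]> \subset P.
    exact: subset_trans (pcore_max px nsxG) (pcore_sub_Hall sylP).
  have cycP: cyclic P by apply: (forall_inP G_Sylow_cyclic); apply: p_Sylow sylP.
  by apply/val_inj/eqP; rewrite (eq_subG_cyclic cycP) // -orderE ox oK.
- move=> uniq_p; have /cyclicP[a def_mu] := cyc_mu.
  have [z prim_z] := @exists_primitive_root R[i] #[a] (order_gt0 a).
  have nsaG: <[a]> <| G by rewrite -def_mu.
  exists (induced G a z), (@induced_act _ _ G a z); apply: induced_free_rep => //.
  move=> g Gg pr_g; rewrite -def_mu -cycle_subG.
  apply: sub_max_cyclic_char (cycle_cyclic g).
  have sgG: <[g]> \subset G by rewrite cycle_subG.
  (* Conjugates of [<[g]>] have the same order, so uniqueness makes it normal. *)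
  rewrite /normal sgG; apply/subsetP=> y Gy.
  have [H [_ uniqH]] := uniq_p _ pr_g (order_dvdG Gg).
  have defH : H = <[g]>%G by apply: uniqH.
  have defHy : H = (<[g]> :^ y)%G by apply: uniqH; rewrite conj_subG //= cardJg.
  by rewrite inE -[<[g]> :^ y]/(gval (<[g]> :^ y)%G) -defHy defH.
Qed.
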